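(* Let $\mathbf{A}$ be an algebra such that every subalgebra $\mathbf{B}$ of $\mathbf{A}\times\mathbf{A}$ generated by $4$ elements satisfies \[\beta\cap(\gamma\circ\delta\circ\gamma)\subseteq (\beta\cap\gamma)+\delta\] for all congruences $\beta,\gamma,\delta$ of $\mathbf{B}$ with $\delta\subseteq\beta$. Then for all reflexive binary relations $R,S$ on $A$ and every congruence $\alpha$ of $\mathbf{A}$, \[\alpha\cap(R+S)\subseteq \big(\alpha\cap\overline{R\cup S^-}\big)+\big(\alpha\cap\overline{R^-\cup S}\big)=\big(\alpha\cap\overline{R\cup S}\big)+\big(\alpha\cap\overline{R^-\cup S^-}\big)=\alpha\cap\big(Cg(R)+Cg(S)\big).\]
   Context: For binary relations $R,S$ on a set, $R\circ S=\{(a,c):\exists b\, aRb,\ bSc\}$, and $R+S=\bigcup_{n\ge1}(R\circ S\circ R\circ S\circ\cdots)$ with $n$ factors alternating; for reflexive $R,S$ this is the transitive closure of $R\cup S$. $R^-=\{(b,a):(a,b)\in R\}$ is the converse of $R$. For a binary relation $R$ on an algebra, $\overline{R}$ denotes the smallest compatible (admissible) relation containing $R$, and $Cg(R)$ the smallest congruence containing $R$. For congruences, $+$ is the join in the congruence lattice. A binary relation is reflexive if it contains the diagonal. *)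

(* Defs.v *)
From Stdlib Require Import Relation_Operators Operators_Properties.
From mathcomp Require Import all_boot.
From mathcomp Require Import boolp classical_sets.

Set Implicit Arguments.
Unset Strict Implicit.
Unset Printing Implicit Defensive.

Local Open Scope classical_set_scope.

(* First R, then S: classical_sets writes composition in the reverse order. *)
Definition relcomp {T : Type} (R S : set (T * T)) : set (T * T) :=
  (S \; R)%relation.

(* R o S o R o S o ... with n factors; the diagonal when n = 0. *)
Fixpoint altcomp {T : Type} (R S : set (T * T)) (n : nat) : set (T * T) :=
  if n is m.+1 then relcomp R (altcomp S R m) else diagonal.

Definition relplus {T : Type} (R S : set (T * T)) : set (T * T) :=
  \bigcup_(n in [set n | 1 <= n]) altcomp R S n.

Definition reflexive_rel {T : Type} (R : set (T * T)) : Prop :=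
  diagonal `<=` R.

Definition symmetric_rel {T : Type} (R : set (T * T)) : Prop :=
  forall x y, R (x, y) -> R (y, x).

Definition transitive_rel {T : Type} (R : set (T * T)) : Prop :=
  forall x y z, R (x, y) -> R (y, z) -> R (x, z).

Lemma altcomp_refl T (R S : set (T * T)) n :
  reflexive_rel R -> reflexive_rel S -> reflexive_rel (altcomp R S n).
Proof.
elim: n R S => [|n IH] R S hR hS //= [x y] xy.
by exists x; [apply: hR | apply: IH].
Qed.

Lemma altcomp_leq T (R S : set (T * T)) m n :
  reflexive_rel R -> reflexive_rel S -> m <= n ->
  altcomp R S m `<=` altcomp R S n.
Proof.
elim: m n R S => [|m IH] n R S hR hS; first by move=> _; apply: altcomp_refl.
case: n => // n mn.
by move=> [x z] [y Rxy yz]; exists y => //; apply: (IH n S R) yz.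
Qed.

Lemma relplusE T (R S : set (T * T)) :
  reflexive_rel R -> reflexive_rel S ->
  relplus R S =
    [set p | clos_trans T (fun x y => (R `|` S) (x, y)) p.1 p.2].
Proof.
move=> hR hS; apply/seteqP; split=> -[x z].
  move=> [n _]; elim: n R S hR hS x => [|n IH] R S hR hS x /=.
    by move=> xz; apply: t_step; left; apply: hR.
  move=> [y Rxy /(IH S R hS hR)]; rewrite setUC /= => yz.
  by apply: t_trans yz; apply: t_step; left.
move=> /= /(@clos_trans_t1n _ _ _ _); elim=> [a b|a b c ab _ [n _ bc]].
  case=> ab; [exists 1%N|exists 2%N] => //=.
    by exists b.
  by exists a; [apply: hR | exists b].
have bc' : altcomp S R n.+1 (b, c) by exists b => //; apply: hS.
case: ab => ab; first by exists n.+2 => //; exists b.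
by exists n.+2 => //; exists a; [apply: hR | exists b].
Qed.

Record signature : Type := Signature {
  symbol :> Type;
  arity : symbol -> nat
}.

Record algebra (s : signature) : Type := Algebra {
  carrier :> Type;
  op : forall f : s, ('I_(arity f) -> carrier) -> carrier
}.

Section Algebras.
Variable s : signature.
Implicit Types A B : algebra s.

Definition prod_alg A B : algebra s :=
  @Algebra s (A * B) (fun f x =>
    (@op s A f (fun i => (x i).1), @op s B f (fun i => (x i).2))).

Definition subuniverse A (U : set A) : Prop :=
  forall (f : s) (x : 'I_(arity f) -> A), (forall i, U (x i)) -> U (op x).

Lemma subuniverse_op A (U : set A) (hU : subuniverse U) (f : s)
  (x : 'I_(arity f) -> U) : op (fun i => val (x i)) \in U.
Proof. exact: mem_set (hU f _ (fun i => set_mem (valP (x i)))). Qed.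

Definition subalg A (U : set A) (hU : subuniverse U) : algebra s :=
  @Algebra s U (fun f x => SigSub (subuniverse_op hU x)).

Lemma smallest_subuniverse A (G : set A) :
  subuniverse (smallest (@subuniverse A) G).
Proof. by move=> f x xG U hU; apply: hU.1 => i; apply: xG. Qed.

Definition gen_subalg A (G : set A) : algebra s :=
  subalg (@smallest_subuniverse A G).

Definition compatible A (R : set (A * A)) : Prop :=
  forall (f : s) (x y : 'I_(arity f) -> A),
    (forall i, R (x i, y i)) -> R (op x, op y).

Definition congruence A (R : set (A * A)) : Prop :=
  [/\ reflexive_rel R, symmetric_rel R, transitive_rel R & compatible R].

Definition compatible_closure A (R : set (A * A)) : set (A * A) :=
  smallest (@compatible A) R.

Definition Cg A (R : set (A * A)) : set (A * A) :=
  smallest (@congruence A) R.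

Lemma compatible_closure_compatible A (R : set (A * A)) :
  compatible (compatible_closure R).
Proof. by move=> f x y xy U hU; apply: hU.1 => i; apply: xy. Qed.

Lemma Cg_congruence A (R : set (A * A)) : congruence (Cg R).
Proof.
split.
- by move=> p pd U [[hU _ _ _] _]; apply: hU.
- by move=> x y xy U hU; case: (hU) => -[_ hs _ _] _; apply: hs; apply: xy.
- move=> x y z xy yz U hU; case: (hU) => -[_ _ ht _] _.
  exact: ht (xy U hU) (yz U hU).
- move=> f x y xy U hU; case: (hU) => -[_ _ _ hc] _.
  by apply: hc => i; apply: xy.
Qed.

Lemma altcomp_compatible A (R S : set (A * A)) n :
  compatible R -> compatible S -> compatible (altcomp R S n).
Proof.
elim: n R S => [|n IH] R S hR hS f x y /= xy.
  by rewrite /diagonal /=; congr op; apply/funext => i; apply: xy.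
have /choice[z hz] : forall i, exists z, R (x i, z) /\ altcomp S R n (z, y i).
  by move=> i; have [z ? ?] := xy i; exists z.
exists (op z) => /=; first by apply: hR => i; case: (hz i).
by apply: (IH S R hS hR f) => i; case: (hz i).
Qed.

(* On congruences, relplus is the join of the congruence lattice. *)
Lemma relplus_join A (R S : set (A * A)) : congruence R -> congruence S ->
  relplus R S = Cg (R `|` S).
Proof.
move=> [rR sR tR cR] [rS sS tS cS]; apply/seteqP; split.
  rewrite (relplusE rR rS) => -[x z] /= xz U [[hr hs ht hc] RSU].
  by elim: xz => [a b /RSU|a b c _ ab _ bc] //; apply: ht ab bc.
apply: smallest_sub; last first.
  by rewrite (relplusE rR rS) => -[x y] xy; apply: t_step.
split.
- by rewrite (relplusE rR rS) => -[x y] xy; apply: t_step; left; apply: rR.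
- rewrite (relplusE rR rS) => x y /=; elim=> [a b [/sR|/sS] ab|a b c _ ba _ cb].
  + by apply: t_step; left.
  + by apply: t_step; right.
  + by apply: t_trans cb ba.
- by rewrite (relplusE rR rS) => x y z /=; apply: t_trans.
- move=> f x y xy.
  have /choice[n hn] : forall i, exists n, altcomp R S n (x i, y i).
    by move=> i; have [n _ ?] := xy i; exists n.
  exists (\max_i n i).+1 => //; apply: altcomp_compatible => // i.
  by apply: altcomp_leq (hn i) => //; apply/leqW/(leq_bigmax i).
Qed.

End Algebras.

(* Main.v *)
(** Put [T := compatible closure of R `|` S^-1], so that [R] lies in [T] and [S] in [T^-1]; everything
    follows from [alpha `&` Cg T = (alpha `&` T) + (alpha `&` T^-1)], valid for every reflexive
    compatible [T]. Let [theta] be the right-hand side, an equivalence relation. If [a U c] and [b U c]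
    with [a alpha b], apply the hypothesis in the subalgebra of [U] generated by (a,a), (a,c), (b,c),
    (b,b), to [alpha * alpha], the kernel of the first projection, and [alpha * 0]: it yields a path from
    (a,a) to (b,b) inside [alpha `&` U] in which one coordinate changes at a time, so [a] and [b] are
    joined by steps of [alpha `&` U] and its converse. Hence [alpha `&` U `<=` theta] passes from [U]
    to [U o U^-1], and iterating this from [U := T] exhausts [Cg T]. *)

Require Import Defs.
From Stdlib Require Import Relation_Operators.
From mathcomp Require Import all_boot.
From mathcomp Require Import boolp classical_sets.

Local Open Scope classical_set_scope.

(** * Reflexive relations, their joins and their zigzags *)

Section Relations.
Context {T : Type}.
Implicit Types R S U : set (T * T).

Definition is_equivalence R : Prop :=
  [/\ reflexive_rel R, symmetric_rel R & transitive_rel R].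

Lemma reflexiveP R : reflexive_rel R <-> forall x, R (x, x).
Proof.
split=> [hR x|hR [x y]]; first exact: hR.
by rewrite /diagonal /= => ->.
Qed.

Lemma inverse_relK R : ((R^-1)^-1)%relation = R.
Proof. by apply/seteqP; split=> -[]. Qed.

Lemma reflexive_inverse {R} : reflexive_rel R -> reflexive_rel R^-1%relation.
Proof. by move=> /reflexiveP hR; apply/reflexiveP. Qed.

Lemma reflexive_setI {R S} :
  reflexive_rel R -> reflexive_rel S -> reflexive_rel (R `&` S).
Proof. by move=> hR hS p pd; split; [apply: hR|apply: hS]. Qed.

Lemma reflexive_subset {R S} : R `<=` S -> reflexive_rel R -> reflexive_rel S.
Proof. by move=> RS hR; apply: subset_trans RS. Qed.

Lemma relplus_sub R S U :
  reflexive_rel R -> reflexive_rel S -> transitive_rel U ->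
  R `<=` U -> S `<=` U -> relplus R S `<=` U.
Proof.
move=> hR hS tU RU SU; rewrite relplusE// => -[x y] /=.
elim=> [a b [/RU|/SU]//|a b c _ ab _ bc]; exact: tU ab bc.
Qed.

Lemma subset_relplus {R S} :
  reflexive_rel R -> reflexive_rel S -> R `|` S `<=` relplus R S.
Proof. by move=> hR hS; rewrite relplusE// => -[x y] xy; apply: t_step. Qed.

Lemma relplus_transitive R S :
  reflexive_rel R -> reflexive_rel S -> transitive_rel (relplus R S).
Proof. by move=> hR hS; rewrite relplusE// => x y z; apply: t_trans. Qed.

Lemma relplus_inverse_symmetric R :
  reflexive_rel R -> symmetric_rel (relplus R R^-1%relation).
Proof.
move=> hR; rewrite relplusE//; last exact: reflexive_inverse.
move=> x y /=; elim=> [a b ab|a b c _ ba _ cb].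
  by apply: t_step; case: ab; [right|left].
exact: t_trans cb ba.
Qed.

Lemma relplus_inverse_equivalence {R} :
  reflexive_rel R -> is_equivalence (relplus R R^-1%relation).
Proof.
move=> hR; have hR' := reflexive_inverse hR; split.
- apply: reflexive_subset (hR).
  by apply: subset_trans (subset_relplus hR hR'); apply: subsetUl.
- exact: relplus_inverse_symmetric.
- exact: relplus_transitive.
Qed.

(** This is the alternating composition of [2 ^ n] factors [R] and [R^-1]. The doubling form makes
    every level [U o U^-1] for the preceding level [U], which is what the induction on [alpha] meets
    needs. *)
Fixpoint zigzag R n : set (T * T) :=
  if n is m.+1 then relcomp (zigzag R m) (zigzag R m)^-1%relation else R.

Lemma zigzag_reflexive R n : reflexive_rel R -> reflexive_rel (zigzag R n).
Proof.
move=> hR; elim: n => //= n /reflexiveP IH.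
by apply/reflexiveP => x; exists x; apply: IH.
Qed.

Lemma zigzag_symmetric R n : symmetric_rel (zigzag R n.+1).
Proof. by move=> x y /= [z xz zy]; exists z. Qed.

Lemma zigzagS R n : reflexive_rel R -> zigzag R n `<=` zigzag R n.+1.
Proof.
move=> hR [x y] xy; exists y => //.
exact: (reflexiveP _).1 (zigzag_reflexive R n hR) y.
Qed.

Lemma zigzag_leq R m n :
  reflexive_rel R -> m <= n -> zigzag R m `<=` zigzag R n.
Proof.
move=> hR; elim: n => [|n IH]; first by rewrite leqn0 => /eqP ->.
rewrite leq_eqVlt ltnS => /predU1P[-> //|/IH mn].
exact: subset_trans mn (zigzagS _ _ hR).
Qed.

End Relations.

(** * Compatible closures and generated congruences *)

Section Algebras.
Context {s : signature} {A : algebra s}.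
Implicit Types R S U alpha theta : set (A * A).

Lemma congruence_diagonal : congruence (diagonal : set (A * A)).
Proof.
split=> //; rewrite /diagonal /=.
- by move=> x y z /= -> ->.
- by move=> f x y xy /=; congr op; apply/funext => i; apply: xy.
Qed.

Lemma congruence_setT : congruence (setT : set (A * A)).
Proof. by []. Qed.

Lemma Cg_sub {R U} : congruence U -> R `<=` U -> Cg R `<=` U.
Proof. exact: smallest_sub. Qed.

Lemma subset_Cg R : R `<=` Cg R.
Proof. exact: sub_gen_smallest. Qed.

Lemma subset_compatible_closure R : R `<=` compatible_closure R.
Proof. exact: sub_gen_smallest. Qed.

Lemma compatible_inverse R : compatible R -> compatible R^-1%relation.
Proof. by move=> cR f x y xy; apply: cR. Qed.

Lemma compatible_relcomp R S :
  compatible R -> compatible S -> compatible (relcomp R S).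
Proof.
move=> cR cS f x y xy.
have /choice[z hz] : forall i, exists z, R (x i, z) /\ S (z, y i).
  by move=> i; have [z ? ?] := xy i; exists z.
by exists (op z); [apply: cR|apply: cS] => i; case: (hz i).
Qed.

(** Converse is an involution that preserves compatibility, so one inclusion, proved for every [Q],
    gives the other when applied to [R^-1]. *)
Lemma compatible_closure_inverse R :
  compatible_closure R^-1%relation = (compatible_closure R)^-1%relation.
Proof.
have sub (Q : set (A * A)) : compatible_closure Q^-1%relation `<=`
    (compatible_closure Q)^-1%relation.
  apply: smallest_sub.
    by apply: compatible_inverse; apply: compatible_closure_compatible.
  by move=> [x y]; apply: (subset_compatible_closure Q).
apply/seteqP; split; first exact: sub.
by have := sub R^-1%relation; rewrite inverse_relK => subR [x y]; apply: subR.
Qed.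

Lemma Cg_compatible_closure R : Cg (compatible_closure R) = Cg R.
Proof.
apply/seteqP; split; apply: Cg_sub; try exact: Cg_congruence.
  apply: smallest_sub (subset_Cg R).
  by have [_ _ _] := Cg_congruence R.
apply: subset_trans (subset_Cg _); exact: subset_compatible_closure.
Qed.

Lemma Cg_setU R S : relplus (Cg R) (Cg S) = Cg (R `|` S).
Proof.
rewrite relplus_join; [|exact: Cg_congruence..].
apply/seteqP; split; apply: Cg_sub; try exact: Cg_congruence.
  rewrite subUset; split; apply: Cg_sub; try exact: Cg_congruence.
    by apply: subset_trans (subset_Cg _); apply: subsetUl.
  by apply: subset_trans (subset_Cg _); apply: subsetUr.
apply: subset_trans (subset_Cg _); apply: setUSS; exact: subset_Cg.
Qed.

Lemma Cg_inverse R : Cg R^-1%relation = Cg R.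
Proof.
have sub (Q : set (A * A)) : Cg Q^-1%relation `<=` Cg Q.
  have [_ sQ _ _] := Cg_congruence Q.
  apply: Cg_sub; first exact: Cg_congruence.
  by move=> [x y] yx; apply: sQ; apply: subset_Cg.
apply/seteqP; split; first exact: sub.
by rewrite -{1}[R]inverse_relK; apply: sub.
Qed.

Lemma zigzag_compatible R n : compatible R -> compatible (zigzag R n).
Proof.
move=> cR; elim: n => //= n IH.
by apply: compatible_relcomp => //; apply: compatible_inverse.
Qed.

(** The levels form an increasing chain of compatible relations. Arities are finite, so the
    arguments of an operation all lie in one common level. *)
Lemma zigzag_congruence {R} : reflexive_rel R -> compatible R ->
  congruence (\bigcup_n zigzag R n).
Proof.
move=> hR cR; split.
- by apply: reflexive_subset hR => p Rp; exists 0.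
- move=> x y [n _ xy]; exists n.+1 => //.
  by apply: (zigzag_symmetric R); apply: (zigzagS _ _ hR).
(* Both pairs are lifted to level [(maxn m n).+1]. Being a successor level it is symmetric, so the
   second pair can be reversed to fit the composition with the converse one level up. *)
- move=> x y z [m _ xy] [n _ yz]; exists (maxn m n).+2 => //; exists y.
    by apply: zigzag_leq xy => //; apply/leqW/leq_maxl.
  apply: (zigzag_symmetric R _).
  by apply: zigzag_leq yz => //; apply/leqW/leq_maxr.
- move=> f x y xy.
  have /choice[n hn] : forall i, exists n, zigzag R n (x i, y i).
    by move=> i; have [n _ ?] := xy i; exists n.
  exists (\max_i n i) => //; apply: zigzag_compatible => // i.
  by apply: zigzag_leq (hn i) => //; apply/(leq_bigmax i).
Qed.

(** * Product congruences on subalgebras of the square, and the meet with [Cg T] *)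

Definition mul_rel R S (U : set (prod_alg A A)) (hU : subuniverse U) :
    set (subalg hU * subalg hU) :=
  [set p | R ((val p.1).1, (val p.2).1) /\ S ((val p.1).2, (val p.2).2)].

Lemma mul_rel_congruence R S (U : set (prod_alg A A)) (hU : subuniverse U) :
  congruence R -> congruence S -> congruence (mul_rel R S U hU).
Proof.
move=> [/reflexiveP rR sR tR cR] [/reflexiveP rS sS tS cS]; split.
- by apply/reflexiveP.
- by move=> x y [/sR ? /sS ?].
- by move=> x y z [xy xy'] [yz yz']; split; [apply: tR yz|apply: tS yz'].
- by move=> f x y xy; split; [apply: cR|apply: cS] => i; case: (xy i).
Qed.

(** The hypothesis of the theorem, named for use in the lemmas. It is the modular law for [delta]
    below [beta], with three alternating factors in place of the join of [gamma] and [delta]. *)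
Definition modular_on_4_generated_squares : Prop :=
  forall (g : 'I_4 -> prod_alg A A)
      (beta gamma delta : set (gen_subalg (range g) * gen_subalg (range g))),
    congruence beta -> congruence gamma -> congruence delta ->
    delta `<=` beta ->
    beta `&` relcomp gamma (relcomp delta gamma)
      `<=` relplus (beta `&` gamma) delta.

(** The inductive step: [theta] stays fixed while [U] grows, so the lemma can be iterated. *)
Lemma meet_relcomp_inverse_sub {alpha theta U} :
  modular_on_4_generated_squares ->
  congruence alpha -> is_equivalence theta ->
  reflexive_rel U -> compatible U -> alpha `&` U `<=` theta ->
  alpha `&` relcomp U U^-1%relation `<=` theta.
Proof.
move=> hA halpha [/reflexiveP rth sth tth] /reflexiveP rU cU Uth.
have [/reflexiveP ral sal tal cal] := halpha.
move=> [a b] [/= ab [c Uac Ubc]].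
pose g : 'I_4 -> prod_alg A A := tnth [tuple (a, a); (a, c); (b, c); (b, b)].
(* Compatibility makes [U] a subuniverse of the square, and it contains the four generators. *)
have gU (u : gen_subalg (range g)) : U (val u).
  apply: (set_mem (valP u)); split.
    move=> f x xU; rewrite [op _]surjective_pairing /=.
    by apply: cU => i; rewrite -surjective_pairing.
  by move=> _ [[[|[|[|[|//]]]] i4] _ <-]; rewrite /g (tnth_nth (a, a)) //=.
pose elt i : gen_subalg (range g) :=
  SigSub (mem_set (sub_gen_smallest (imageT g i))).
pose beta := mul_rel alpha alpha _ (@smallest_subuniverse _ _ (range g)).
pose gamma := mul_rel diagonal setT _ (@smallest_subuniverse _ _ (range g)).
pose delta := mul_rel alpha diagonal _ (@smallest_subuniverse _ _ (range g)).
have hgamma : congruence gamma.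
  exact: mul_rel_congruence congruence_diagonal congruence_setT.
have hdelta : congruence delta.
  exact: mul_rel_congruence halpha congruence_diagonal.
have hbeta : congruence beta by exact: mul_rel_congruence.
have delta_beta : delta `<=` beta.
  move=> [u v] [uv uv2]; split=> //=.
  by rewrite (uv2 : (val u).2 = (val v).2); apply: ral.
(* An invariant to carry along a path that starts at [(a, a)]: the path never leaves [alpha], and
   its first coordinates stay in one [theta] class. The implication makes the relation transitive,
   so single links suffice. *)
pose near_diag := [set p : gen_subalg (range g) * gen_subalg (range g) |
  alpha (val p.1) -> alpha (val p.2) /\ theta ((val p.1).1, (val p.2).1)].
have near_diag_trans : transitive_rel near_diag.
  move=> u v w uv vw /uv[/= av uv1]; have [aw vw1] := vw av.
  by split=> //; apply: tth vw1.
suff path_sub : relplus (beta `&` gamma) delta `<=` near_diag.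
  have : near_diag (elt (inord 0), elt (inord 3)).
    apply/path_sub/hA => //; split.
      by split; rewrite /= /g !(tnth_nth (a, a)) !inordK.
    (* The path is [(a, a)] gamma [(a, c)] delta [(b, c)] gamma [(b, b)]. *)
    exists (elt (inord 1)); last exists (elt (inord 2)).
    - by split; rewrite //= /diagonal /= /g !(tnth_nth (a, a)) !inordK.
    - by split; rewrite /= /diagonal /= /g !(tnth_nth (a, a)) !inordK.
    - by split; rewrite //= /diagonal /= /g !(tnth_nth (a, a)) !inordK.
  rewrite /near_diag /= /g !(tnth_nth (a, a)) !inordK //=.
  by move=> /(_ (ral a))[].
have [rbeta _ _ _] := hbeta; have [rgamma _ _ _] := hgamma.
have [rdelta _ _ _] := hdelta.
apply: relplus_sub => //; first exact: reflexive_setI.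
  (* A link in [beta] and [gamma] fixes the first coordinate and moves the second inside its [alpha]
     class. *)
  move=> [u v] [[/= _ uv2] [uv1 _]] au; rewrite /= in au.
  have {}uv1 : (val u).1 = (val v).1 := uv1.
  rewrite /= -uv1; split=> //.
  rewrite [val v]surjective_pairing -uv1; apply: tal uv2.
  by rewrite -surjective_pairing.
(* A [delta] link keeps the second coordinate [d]. Both first coordinates are related to [d] by
   [alpha] and [U], hence by [theta], and so to each other. *)
move=> [u v] [/= uv1 uv2] /= au.
have {}uv2 : (val u).2 = (val v).2 := uv2.
have au' : alpha ((val u).1, (val u).2) by rewrite -surjective_pairing.
have av : alpha (val v).
  by rewrite [val v]surjective_pairing -uv2; apply: tal au'; apply: sal.
split=> //; apply: (tth _ (val u).2).
  by apply: Uth; rewrite -surjective_pairing.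
by apply: sth; apply: Uth; rewrite uv2 -surjective_pairing.
Qed.

Lemma meet_Cg alpha T :
  modular_on_4_generated_squares ->
  congruence alpha -> reflexive_rel T -> compatible T ->
  relplus (alpha `&` T) (alpha `&` T^-1%relation) = alpha `&` Cg T.
Proof.
move=> hA halpha hT cT; have [ral sal tal cal] := halpha.
have raT := reflexive_setI ral hT.
(* By symmetry of [alpha] the two summands are converse to each other, so their join is an
   equivalence and can serve as [theta]. *)
have raT' : alpha `&` T^-1%relation = (alpha `&` T)^-1%relation.
  by apply/seteqP; split=> -[x y] [/sal xy ?].
apply/seteqP; split.
  have [_ sC tC _] := Cg_congruence T.
  apply: relplus_sub; [by []|exact: reflexive_setI ral (reflexive_inverse hT)|..].
  - by move=> x y z [xy xy'] [yz yz']; split; [apply: tal yz|apply: tC yz'].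
  - by apply: setIS; apply: subset_Cg.
  - by apply: setIS => -[x y] yx; apply: sC; apply: subset_Cg.
rewrite raT'; have hth := relplus_inverse_equivalence raT.
have step n : alpha `&` zigzag T n `<=`
    relplus (alpha `&` T) (alpha `&` T)^-1%relation.
  elim: n => [|n IH] /=; last first.
    apply: meet_relcomp_inverse_sub hA _ hth _ _ IH => //.
      exact: zigzag_reflexive.
    exact: zigzag_compatible.
  apply: subset_trans (subset_relplus raT (reflexive_inverse raT)).
  exact: subsetUl.
move=> p [ap Tp].
have [|n _ np] := Cg_sub (zigzag_congruence hT cT) _ _ Tp; last first.
  exact: (step n).
by move=> q Tq; exists 0.
Qed.

End Algebras.

Theorem theorem2p1 (s : signature) (A : algebra s)
  (hA : forall (g : 'I_4 -> prod_alg A A)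
      (beta gamma delta : set (gen_subalg (range g) * gen_subalg (range g))),
    congruence beta -> congruence gamma -> congruence delta ->
    delta `<=` beta ->
    beta `&` relcomp gamma (relcomp delta gamma)
      `<=` relplus (beta `&` gamma) delta)
  (R S alpha : set (A * A))
  (hR : reflexive_rel R) (hS : reflexive_rel S) (halpha : congruence alpha) :
  [/\ alpha `&` relplus R S
        `<=` relplus (alpha `&` compatible_closure (R `|` S^-1%relation))
               (alpha `&` compatible_closure (R^-1%relation `|` S)),
      relplus (alpha `&` compatible_closure (R `|` S^-1%relation))
          (alpha `&` compatible_closure (R^-1%relation `|` S))
        = relplus (alpha `&` compatible_closure (R `|` S))
            (alpha `&` compatible_closure (R^-1%relation `|` S^-1%relation))
    & relplus (alpha `&` compatible_closure (R `|` S))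
          (alpha `&` compatible_closure (R^-1%relation `|` S^-1%relation))
        = alpha `&` relplus (Cg R) (Cg S)].
Proof.
have hS' := reflexive_inverse hS.
(* Here [T] is the compatible closure of the union of [R] and [Q]. Taking [Q := S] gives the last
   equality, and [Q := S^-1] the mixed one. *)
have meet_Cg_setU Q : reflexive_rel Q ->
    relplus (alpha `&` compatible_closure (R `|` Q))
      (alpha `&` compatible_closure (R^-1%relation `|` Q^-1%relation)) =
    alpha `&` relplus (Cg R) (Cg Q).
  move=> hQ; rewrite Cg_setU -Cg_compatible_closure.
  rewrite -[R^-1%relation `|` _]/((R `|` Q)^-1%relation).
  rewrite compatible_closure_inverse meet_Cg//.
    apply: reflexive_subset (hR).
    by apply: subset_trans (subset_compatible_closure _); apply: subsetUl.
  exact: compatible_closure_compatible.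
have mixed : relplus (alpha `&` compatible_closure (R `|` S^-1%relation))
    (alpha `&` compatible_closure (R^-1%relation `|` S)) =
    alpha `&` relplus (Cg R) (Cg S).
  by have := meet_Cg_setU _ hS'; rewrite Cg_inverse inverse_relK.
split; last exact: meet_Cg_setU.
(* Once the right-hand side is a meet with [Cg (R U S)], it suffices that this congruence is
   transitive and contains [R] and [S]. *)
- rewrite mixed Cg_setU; apply: setIS.
  have [_ _ tC _] := Cg_congruence (R `|` S).
  apply: relplus_sub => //; apply: subset_trans (subset_Cg _).
    exact: subsetUl.
  exact: subsetUr.
- by rewrite mixed meet_Cg_setU.
Qed.
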